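(* Fix integers $q\ge 3$, $m\ge 1$, and reals $\lambda\in(0,1)$, $J>0$. Consider the Glauber dynamics of the homogeneous $m$-component Curie-Weiss-Potts model with $q$ spins, component size $N$, and inverse temperature $\beta>0$, and let $t_{\mathrm{MIX}}=t_{\mathrm{MIX}}(N)$ be its mixing time. If $\beta>\beta_s(q)/J$, then $$t_{\mathrm{MIX}}=\exp(\Omega(N)),$$ i.e. there are a constant $c>0$ (independent of $N$) and $N_0$ such that $t_{\mathrm{MIX}}(N)\ge e^{cN}$ for all $N\ge N_0$.
   Context: Model. The parameters $q,m,\lambda,J,\beta$ are fixed and do not depend on $N$. The vertex set $V$ has $Nm$ elements and is partitioned into $m$ components $V_1,\dots,V_m$, each of size $N$. Configurations are the elements $\sigma$ of $\Sigma=\{1,\dots,q\}^V$. For $v,w\in V$ set $\mathcal J(v,w)=\frac{J}{1+(m-1)\lambda}$ if $v,w$ lie in the same component and $\mathcal J(v,w)=\frac{J\lambda}{1+(m-1)\lambda}$ if they lie in different components. The Gibbs measure is $$\mu_{N,\beta}(\sigma)=\frac1{Z_{N,\beta}}\exp\Big(\frac{\beta}{N}\sum_{v,w\in V}\mathcal J(v,w)\mathbf 1\{\sigma(v)=\sigma(w)\}\Big),$$ where the sum is over all ordered pairs $(v,w)$ and $Z_{N,\beta}$ is the normalizing constant. Glauber dynamics. The discrete-time Markov chain $(\sigma_t)_{t\ge0}$ on $\Sigma$ that at each step picks a vertex $v\in V$ uniformly at random and resamples the spin at $v$ from $\mu_{N,\beta}$ conditioned on the spins at all vertices $w\neq v$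 being unchanged. $\mathbb P_\sigma$ is the law of the chain started from $\sigma$. Mixing time. $t_{\mathrm{MIX}}=\inf\{t>0:\max_{\sigma\in\Sigma}\|\mathbb P_\sigma[\sigma_t\in\cdot]-\mu_{N,\beta}\|_{\mathrm{TV}}\le 1/4\}$. Threshold. $\beta_s(q)=\sup\Big\{\beta>0:\big(1+(q-1)e^{2\beta\frac{1-qx}{q-1}}\big)^{-1}-x\neq0\ \text{for all }x\in(1/q,1)\Big\}$. *)

(* Defs.v *)
From mathcomp Require Import all_boot all_order all_algebra.
From mathcomp Require Import all_classical all_reals all_analysis.

Set Implicit Arguments.
Unset Strict Implicit.
Unset Printing Implicit Defensive.

Import Order.TTheory GRing.Theory Num.Theory.

Local Open Scope classical_set_scope.
Local Open Scope ring_scope.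

(* The vertex (k, i) is the i-th vertex of the component V_k; spins are
   labelled 0, ..., q - 1. *)
Definition vertex (m N : nat) : finType := ('I_m * 'I_N)%type.

Definition config (q m N : nat) : finType := {ffun vertex m N -> 'I_q}.

Definition coupling (R : realType) (lambda J : R) (m N : nat)
    (v w : vertex m N) : R :=
  if v.1 == w.1 then J / (1 + (m%:R - 1) * lambda)
  else J * lambda / (1 + (m%:R - 1) * lambda).

Definition gibbs_weight (R : realType) (lambda J beta : R) (q m N : nat)
    (sigma : config q m N) : R :=
  expR (beta / N%:R *
        \sum_(v : vertex m N) \sum_(w : vertex m N)
          coupling lambda J v w * (sigma v == sigma w)%:R).

Definition partition_function (R : realType) (lambda J beta : R)
    (q m N : nat) : R :=
  \sum_(sigma : config q m N) gibbs_weight lambda J beta sigma.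

Definition gibbs (R : realType) (lambda J beta : R) (q m N : nat)
    (sigma : config q m N) : R :=
  gibbs_weight lambda J beta sigma / partition_function lambda J beta q m N.

Definition agree_off (q m N : nat) (v : vertex m N)
    (sigma tau : config q m N) : bool :=
  [forall w, (w != v) ==> (tau w == sigma w)].

(* The Gibbs probability of tau conditioned on agreement with sigma at every
   vertex other than v. *)
Definition gibbs_cond (R : realType) (lambda J beta : R) (q m N : nat)
    (v : vertex m N) (sigma tau : config q m N) : R :=
  (if agree_off v sigma tau then gibbs lambda J beta tau else 0) /
  \sum_(eta : config q m N | agree_off v sigma eta) gibbs lambda J beta eta.

Definition glauber_kernel (R : realType) (lambda J beta : R) (q m N : nat)
    (sigma tau : config q m N) : R :=
  \sum_(v : vertex m N)
    #|vertex m N|%:R^-1 * gibbs_cond lambda J beta v sigma tau.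

(* [glauber_law lambda J beta t sigma tau] is P_sigma[sigma_t = tau]. *)
Fixpoint glauber_law (R : realType) (lambda J beta : R) (q m N : nat)
    (t : nat) (sigma tau : config q m N) : R :=
  if t is t'.+1 then
    \sum_(eta : config q m N)
      glauber_law lambda J beta t' sigma eta
      * glauber_kernel lambda J beta eta tau
  else (tau == sigma)%:R.

(* All the values are nonnegative, so the default value 0 of the maximum is
   harmless, here and in [glauber_dist]. *)
Definition tv_dist (R : realType) (T : finType) (mu nu : T -> R) : R :=
  \big[Num.max/0]_(A : {set T}) `|\sum_(x in A) mu x - \sum_(x in A) nu x|.

Definition glauber_dist (R : realType) (lambda J beta : R) (q m N : nat)
    (t : nat) : R :=
  \big[Num.max/0]_(sigma : config q m N)
    tv_dist (glauber_law lambda J beta t sigma) (gibbs lambda J beta (N:=N)).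

Definition mixing_time (R : realType) (lambda J beta : R) (q m N : nat)
    : \bar R :=
  ereal_inf [set (t%:R)%:E | t in
    [set t : nat | (0 < t)%N /\ glauber_dist lambda J beta q m N t <= 1 / 4]].

(* For q >= 3 the set is nonempty and bounded above, so that [sup] is its
   least upper bound. *)
Definition beta_s (R : realType) (q : nat) : R :=
  sup [set beta : R | 0 < beta /\
    forall x : R, 1 / q%:R < x -> x < 1 ->
      (1 + (q%:R - 1) * expR (2 * beta * ((1 - q%:R * x) / (q%:R - 1))))^-1 - x
      != 0].

(* Main.v *)
Require Import Defs.
From mathcomp Require Import all_boot all_order all_algebra.
From mathcomp Require Import all_classical all_reals all_analysis.
From mathcomp Require Import perm ring lra.

Import Order.TTheory GRing.Theory Num.Theory.
Import numFieldNormedType.Exports.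

Local Open Scope ring_scope.

(* Let B = beta J. Beyond the threshold, the mean-field map has a fixed point
   p = (s, t, ..., t) with t < s at which the free energy has a strict local
   maximum. As p is a fixed point and the energy is quadratic, the Gibbs
   weight of a configuration is, up to a constant, its weight under i.i.d.
   spins of law p times exp(N E(y)), where y is the deviation of the m
   empirical spin distributions from p and 0 <= E(y) <= B |y|^2. Summing
   Chernoff's bound over the polynomially many spin counts gives the shell
   delta^2/2 <= |y|^2 <= delta^2 a Gibbs mass exponentially smaller than that
   of the ball |y|^2 <= delta^2. The ball has mass at most 1/2, being disjoint
   from its image under a transposition of colours, and the chain can leave it
   only through the shell. Hence the chain started from the Gibbs measure
   conditioned on the ball needs exponentially many steps to escape. *)

Set Implicit Arguments.
Unset Strict Implicit.
Unset Printing Implicit Defensive.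

(** * The drift and the threshold *)

(** The difference of the two sides vanishes at 0 and its derivative has the sign of [t] near 0. A
    coefficient arbitrarily close to 1/2 matters in [sqdev_shell], where the gap [kappa] may be
    small. *)
Lemma expR_le_quadratic (R : realType) (e : R) : 0 < e ->
  exists2 d : R, 0 < d &
    forall t, `|t| <= d -> expR t <= 1 + t + (1 / 2 + e) * t ^+ 2.
Proof.
move=> e0; pose d : R := Num.min (1 / 2) e.
have d0 : 0 < d by rewrite lt_min e0 divr_gt0.
have d2 : d <= 1 / 2 by rewrite ge_min lexx.
have de : d <= e by rewrite ge_min lexx orbT.
exists d => // t td.
pose g (x : R) : R := 1 + x + (1 / 2 + e) * x ^+ 2 - expR x.
pose dg (x : R) : R := 1 + (1 + 2 * e) * x - expR x.
have gE (x : R) : is_derive x 1 g (dg x).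
  by apply: is_derive_eq; rewrite /dg /GRing.scale /=; lra.
have gc (a b : R) : {within `[a, b], continuous g}%classic.
  apply: derivable_within_continuous => x _; exact: ex_derive.
have g0 : g 0 = 0 by rewrite /g expR0; lra.
suff : 0 <= g t by rewrite /g; lra.
(* Here [expR x <= 1 / (1 - x)], and [1 <= (1 - x) * (1 + (1 + 2 * e) * x)] amounts to
   [(1 + 2 * e) * x <= 2 * e], which follows from [x <= 1 / 2] and [x <= e]. *)
have dgp (x : R) : 0 < x -> x <= d -> 0 <= dg x.
  move=> x0 xd; rewrite /dg.
  have := expR_ge1Dx (- x); rewrite expRN => h.
  have e0x := expR_gt0 x.
  have h1 : (1 - x) * expR x <= 1 by rewrite -ler_pdivlMr // div1r.
  have h2 : 1 <= (1 - x) * (1 + (1 + 2 * e) * x).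
    have : (1 + 2 * e) * x <= 2 * e by nra.
    by nra.
  have h3 : (1 - x) * expR x <= (1 - x) * (1 + (1 + 2 * e) * x).
    exact: le_trans h1 h2.
  by rewrite subr_ge0; move: h3; rewrite ler_pM2l // subr_gt0; lra.
have dgn (x : R) : x < 0 -> dg x <= 0.
  by move=> x0; rewrite /dg; have := expR_ge1Dx x; nra.
move: td; rewrite ler_norml => /andP[td1 td2].
case: (ltgtP t 0) => [t0|t0|->]; last by rewrite g0.
- have [c /[!in_itv]/= /andP[tc c0]] := MVT t0 (fun x _ => gE x) (gc _ _).
  by rewrite g0; have := dgn _ c0; nra.
- have [c /[!in_itv]/= /andP[tc c0]] := MVT t0 (fun x _ => gE x) (gc _ _).
  by rewrite g0; have := dgp _ tc (le_trans (ltW c0) td2); nra.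
Qed.

(** The first term is the softmax weight of colour one at the profile [(x, y, ..., y)] with
    [y = (1 - x) / (q - 1)], because [y - x = (1 - q x) / (q - 1)]. Zeros are thus fixed points of
    the mean-field map. *)
Definition drift (R : realType) (q : nat) (B x : R) : R :=
  (1 + (q%:R - 1) * expR (2 * B * ((1 - q%:R * x) / (q%:R - 1))))^-1 - x.

Lemma drift_denom_gt1 (R : realType) (q : nat) (u : R) : (1 < q)%N ->
  1 < 1 + (q%:R - 1) * expR u.
Proof.
by move=> q1; rewrite ltrDl mulr_gt0 ?expR_gt0 // subr_gt0 ltr1n.
Qed.

Lemma continuous_drift (R : realType) (q : nat) (B : R) : (1 < q)%N ->
  continuous (drift q B).
Proof.
move=> q1 x; apply: differentiable_continuous; apply/derivable1_diffP.
apply: derivableB => //; apply: derivableV => //.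
by rewrite gt_eqF // (lt_trans ltr01) ?drift_denom_gt1.
Qed.

(** Intermediate values: the drift is negative at 1, its first term being below 1. *)
Lemma drift_zero (R : realType) (q : nat) (B x : R) : (1 < q)%N ->
  x < 1 -> 0 < drift q B x ->
  exists z : R, [/\ x < z, z < 1 & drift q B z = 0].
Proof.
move=> q1 x1 Dx.
have D1 : drift q B 1 < 0.
  by rewrite /drift subr_lt0 invf_lt1 ?drift_denom_gt1 // (lt_trans ltr01)
    ?drift_denom_gt1.
have [||z /[!in_itv]/= /andP[xz z1] Dz] := @IVT R (drift q B) x 1 0 (ltW x1).
- by apply: continuous_subspaceT => y; exact: continuous_drift.
- by rewrite ge_min le_max (ltW D1) (ltW Dx) orbT.
exists z; split => //.
- by rewrite lt_neqAle xz andbT; apply: contraTneq Dx => ->; rewrite Dz ltxx.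
- by rewrite lt_neqAle z1 andbT; apply: contraTneq D1 => <-; rewrite Dz ltxx.
Qed.

Lemma drift_gt0E (R : realType) (q : nat) (B x : R) : (1 < q)%N ->
  0 < x -> x < 1 ->
  (0 < drift q B x) = (x * ((q%:R - 1) * expR (2 * B * ((1 - q%:R * x) / (q%:R
    - 1)))) < 1 - x).
Proof.
move=> q1 x0 x1; rewrite /drift subr_gt0.
set u := _ * expR _.
have u1 : 0 < 1 + u by rewrite (lt_trans ltr01) ?drift_denom_gt1.
rewrite -[x in LHS](invrK x) ltf_pV2 ?posrE ?invr_gt0 //.
by rewrite -[_^-1]div1r ltr_pdivlMr // mulrC mulrDr mulr1 -ltrBrDl.
Qed.

Lemma drift_eq0E (R : realType) (q : nat) (B x : R) : (1 < q)%N ->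
  drift q B x = 0 ->
  x * ((q%:R - 1) * expR (2 * B * ((1 - q%:R * x) / (q%:R - 1)))) = 1 - x.
Proof.
move=> q1 /eqP; rewrite /drift subr_eq0.
set u := _ * expR _ => /eqP <-.
have u1 : 0 < 1 + u by rewrite (lt_trans ltr01) ?drift_denom_gt1.
by field; rewrite gt_eqF.
Qed.

(** Beyond [1 / q] the coefficient of [B] in the exponent is negative, so the drift is strictly
    increasing in [B]. *)
Lemma drift_gt0_incr (R : realType) (q : nat) (B B' x : R) : (1 < q)%N ->
  1 / q%:R < x -> x < 1 -> B' < B -> 0 <= drift q B' x -> 0 < drift q B x.
Proof.
move=> q1 x0 x1 BB; rewrite le_eqVlt => /orP h.
have q0 : 0 < q%:R :> R by rewrite ltr0n (ltn_trans _ q1).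
have xp : 0 < x by apply: lt_trans x0; rewrite divr_gt0.
have qq : 0 < q%:R - 1 :> R by rewrite subr_gt0 ltr1n.
rewrite drift_gt0E //.
apply: (@lt_le_trans _ _ (x * ((q%:R - 1) * expR (2 * B' * ((1 - q%:R * x) /
  (q%:R - 1)))))).
  rewrite !ltr_pM2l // ltr_expR.
  have neg : (1 - q%:R * x) / (q%:R - 1) < 0.
    rewrite pmulr_llt0 ?invr_gt0 // subr_lt0.
    by move: x0; rewrite ltr_pdivrMr // mulrC.
  by rewrite ltr_nM2r // ltr_pM2l.
case: h => [/eqP h|h]; first by rewrite drift_eq0E.
by move: h; rewrite drift_gt0E // => /ltW.
Qed.

(** Some [b < B] lies outside the set defining [beta_s], so the drift has a zero at [b];
    monotonicity in the temperature parameter makes it positive there at [B]. *)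
Lemma drift_gt0_above_beta_s (R : realType) (q : nat) (B : R) : (3 <= q)%N ->
  0 < B -> beta_s R q < B -> exists x : R, [/\ 1 / q%:R < x,
    x < 1 & 0 < drift q B x].
Proof.
move=> q3 B0 hB.
have q1 : (1 < q)%N by exact: ltn_trans q3.
have q3R : 3 <= q%:R :> R by rewrite ler_nat.
pose b1 : R := (q%:R - 1) ^+ 2.
have ub : has_ubound [set b : R | 0 < b /\ forall x : R,
  1 / q%:R < x -> x < 1 -> drift q b x != 0].
  (* For [b > (q - 1) ^ 2] the drift is already positive at 1/2, by [1 + u <= expR u], and so has a
     zero in (1/2, 1). *)
  exists b1 => b [b0 hb]; rewrite leNgt; apply/negP => bB.
  have hq : 1 / q%:R < 1 / 2 :> R.
    by rewrite ltr_pM2l // ltf_pV2 ?posrE ?ltr_nat //; lra.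
  have [||z [xz z1 /eqP]] := @drift_zero R q b (1 / 2) q1.
  - lra.
  - rewrite drift_gt0E //; try lra.
    set u := 2 * b * _.
    have ue : u = - (b * (q%:R - 2) / (q%:R - 1)) by rewrite /u; field; lra.
    have := expR_ge1Dx (- u); rewrite expRN.
    have : q%:R - 1 < - u.
      rewrite ue opprK ltr_pdivlMr; last lra.
      by move: bB; rewrite /b1; nra.
    move=> h1 h2; have h3 : q%:R - 1 < (expR u)^-1 by lra.
    move: h3; rewrite -[_^-1]div1r ltr_pdivlMr ?expR_gt0 //; lra.
  by apply/negP/hb => //; apply: lt_trans xz.
have [b [bB [x [x0 x1 Dx]]]] : exists b : R, b < B /\ exists x : R,
  [/\ 1 / q%:R < x, x < 1 & drift q b x = 0].
  (* The maximum with 0 makes [b] positive, so that [b] can fail membership only by having a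
     zero. *)
  pose b := (B + Num.max 0 (beta_s R q)) / 2.
  have mB : Num.max 0 (beta_s R q) < B by rewrite gt_max B0.
  have m0 : 0 <= Num.max 0 (beta_s R q) by rewrite le_max lexx.
  have ms : beta_s R q <= Num.max 0 (beta_s R q) by rewrite le_max lexx orbT.
  exists b; split; first by rewrite /b; lra.
  have : ~ (0 < b /\ forall x : R, 1 / q%:R < x -> x < 1 -> drift q b x != 0).
    move=> /(ub_le_sup ub); rewrite -/(beta_s R q) /b; lra.
  move=> /not_andP[|/existsNP[x /not_implyP[x0 /not_implyP[x1 /negP]]]].
    by rewrite /b; lra.
  by rewrite negbK => /eqP Dx; exists x.
exists x; split => //; apply: drift_gt0_incr bB _ => //; by rewrite Dx.
Qed.

(* [s] is a zero of the drift beyond a point where it is positive.  With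
   [h x = 2B(qx - 1)/(q - 1) - ln (x/(1 - x)) - ln (q - 1)], which has the
   sign of the drift and vanishes at [1/q], two applications of the mean value
   theorem give [c < d < s] with [h' c > 0 > h' d], and the sign of [h' x] is
   that of [x(1 - x) - (q - 1)/(2Bq)], concave in [x]. *)
Lemma stable_fixpoint (R : realType) (q : nat) (B : R) : (3 <= q)%N ->
  0 < B -> beta_s R q < B ->
  exists s t : R, [/\ 0 < t, t < s, s + (q%:R - 1) * t = 1,
    t = s * expR (2 * B * (t - s)) & 2 * B * q%:R * s * t < 1].
Proof.
move=> q3 B0 hB.
have q1 : (1 < q)%N by exact: ltn_trans q3.
have q3R : 3 <= q%:R :> R by rewrite ler_nat.
have [x [qx x1 Dx]] := drift_gt0_above_beta_s q3 B0 hB.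
have [s [xs s1 Ds]] := drift_zero q1 x1 Dx.
have q0 : 0 < 1 / q%:R :> R by rewrite divr_gt0 //; lra.
pose h (x : R) := 2 * B * ((q%:R * x - 1) / (q%:R - 1)) - ln x + ln (1 - x) -
  ln (q%:R - 1).
pose dh (x : R) := 2 * B * (q%:R / (q%:R - 1)) - x^-1 - (1 - x)^-1.
have hE (y : R) : 0 < y -> y < 1 -> is_derive y 1 h (dh y).
  move=> y0 y1.
  have lny := is_derive1_ln y0.
  have y1' : 0 < 1 - y by lra.
  have dy : is_derive y 1 (fun z : R => 1 - z) (-1).
    by apply: is_derive_eq; lra.
  have ln1y := @is_derive1_comp _ (@ln R) (fun z =>
    1 - z) y _ _ (is_derive1_ln y1') dy.
  have lin : is_derive y 1 (fun z : R =>
    2 * B * ((q%:R * z - 1) / (q%:R - 1))) (2 * B * (q%:R / (q%:R - 1))).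
    by apply: is_derive_eq; rewrite /GRing.scale /=; field; lra.
  have := is_deriveB (is_deriveD (is_deriveB lin lny) ln1y) (is_derive_cst (ln
    (q%:R - 1 : R)) y 1).
  move=> hh; apply: (is_derive_eq hh); by rewrite /dh subr0 mulrN1.
have hc (a b : R) : 0 < a -> b < 1 -> {within `[a, b], continuous h}%classic.
  move=> a0 b1; apply: derivable_within_continuous =>
    y /[!in_itv]/= /andP[ay yb].
  have yh : is_derive y 1 h (dh y) by apply: hE; lra.
  exact: ex_derive.
have lnD (y : R) : 0 < y -> y < 1 -> 
   ln (y * ((q%:R - 1) * expR (2 * B * ((1 - q%:R * y) / (q%:R - 1))))) = ln (1
     - y) - h y.
  move=> y0 y1.
  rewrite !lnM ?posrE ?mulr_gt0 ?expR_gt0 ?subr_gt0 ?ltr1n // expRK /h.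
  have -> : (1 - q%:R * y) / (q%:R - 1) = - ((q%:R * y - 1) / (q%:R - 1)).
    by field; lra.
  lra.
have hq : h (1 / q%:R) = 0.
  rewrite /h.
  have -> : 1 - 1 / q%:R = (q%:R - 1) / q%:R :> R by field; lra.
  rewrite ln_div ?posrE ?ln_div ?posrE ?ln1; try lra.
  have -> : q%:R * (1 / q%:R) - 1 = 0 :> R by field; lra.
  by rewrite mul0r mulr0; lra.
have hx : 0 < h x.
  have x0 : 0 < x by lra.
  have : ln (x * ((q%:R - 1) * expR (2 * B * ((1 - q%:R * x) / (q%:R - 1))))) <
    ln (1 - x).
    rewrite ltr_ln ?posrE -?drift_gt0E //.
      by rewrite !mulr_gt0 ?expR_gt0 ?subr_gt0 ?ltr1n.
    by lra.
  by rewrite lnD //; lra.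
have s0 : 0 < s by lra.
have Es := drift_eq0E q1 Ds.
have hs : h s = 0.
  by have := lnD s s0 s1; rewrite Es; lra.
have [c /[!in_itv]/= /andP[qc cx] hc'] := @MVT _ h dh _ _ qx (fun y hy =>
  hE y ltac:(move: hy; rewrite in_itv/=; lra) ltac:(move: hy; rewrite in_itv/=;
  lra)) (hc _ _ q0 x1).
have x0 : 0 < x by lra.
have [d /[!in_itv]/= /andP[xd ds] hd] := @MVT _ h dh _ _ xs (fun y hy =>
  hE y ltac:(move: hy; rewrite in_itv/=; lra) ltac:(move: hy; rewrite in_itv/=;
  lra)) (hc _ _ x0 s1).
have dc0 : 0 < dh c.
  by rewrite -(@pmulr_lgt0 _ (x - 1 / q%:R)) -?hc' ?hq; lra.
have dd0 : dh d < 0.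
  by rewrite -(@pmulr_llt0 _ (s - x)) -?hd ?hs; lra.
pose K := 2 * B * (q%:R / (q%:R - 1)).
have dhE y : 0 < y -> y < 1 -> dh y = (K * (y * (1 - y)) - 1) / (y * (1 - y)).
  by move=> y0 y1; rewrite /dh -/K; field; apply/andP; split; lra.
have K0 : 0 < K by rewrite /K !mulr_gt0 ?invr_gt0; lra.
have Kc : 0 < K * (c * (1 - c)) - 1.
  by move: dc0; rewrite dhE ?pmulr_lgt0 ?invr_gt0 ?mulr_gt0; lra.
have Kd : K * (d * (1 - d)) - 1 < 0.
  by move: dd0; rewrite dhE ?pmulr_llt0 ?invr_gt0 ?mulr_gt0; lra.
(* As [c < d], this puts [d] to the right of 1/2, where [y * (1 - y)] decreases; the bound at [d]
   then passes on to [s]. *)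
have cd1 : 1 < c + d.
  have : c * (1 - c) > d * (1 - d) by rewrite -(ltr_pM2l K0); lra.
  by nra.
have Ks : K * (s * (1 - s)) < 1.
  have : s * (1 - s) < d * (1 - d) by nra.
  by rewrite -(ltr_pM2l K0); lra.
(* With this [t], [K * (s * (1 - s))] is [2 * B * q * s * t]. *)
exists s, ((1 - s) / (q%:R - 1)).
have qm : 0 < q%:R - 1 :> R by lra.
have qs : 1 < q%:R * s by rewrite mulrC -ltr_pdivrMr; lra.
split.
- by rewrite divr_gt0 //; lra.
- by rewrite ltr_pdivrMr //; lra.
- by field; lra.
- have -> : (1 - s) / (q%:R - 1) - s = (1 - q%:R * s) / (q%:R - 1) by field;
  lra.
  by rewrite -Es; field; lra.
- by move: Ks; rewrite /K; congr (_ < _); field; lra.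
Qed.

(** * Escape from a set under the Glauber dynamics *)

Fixpoint kernel_power (R : realType) (T : finType) (P : T -> T -> R) (t : nat)
    (x y : T) : R :=
  if t is t'.+1 then \sum_z kernel_power P t' x z * P z y else (y == x)%:R.

Lemma kernel_power_ge0 (R : realType) (T : finType) (P : T -> T -> R) (t : nat)
    (x y : T) : (forall x y, 0 <= P x y) -> 0 <= kernel_power P t x y.
Proof.
move=> P0; elim: t y => [|t IH] y /=; first by rewrite ler0n.
by apply: sumr_ge0 => z _; rewrite mulr_ge0.
Qed.

Lemma stationary_kernel_power (R : realType) (T : finType) (P : T -> T -> R)
    (p : T -> R) (t : nat) (y : T) :
  (forall y, \sum_x p x * P x y = p y) ->
  \sum_x p x * kernel_power P t x y = p y.
Proof.
move=> pP; elim: t y => [|t IH] y /=.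
  rewrite (bigD1 y) //= eqxx mulr1 big1 ?addr0 // => x /negPf xy.
  by rewrite eq_sym xy mulr0.
under eq_bigr do rewrite mulr_sumr.
rewrite exchange_big /= -[RHS]pP; apply: eq_bigr => z _.
by rewrite -[in RHS]IH mulr_suml; apply: eq_bigr => x _; rewrite mulrA.
Qed.

(** Start the chain from [p] restricted to [S]. By stationarity its mass never exceeds [p]
    pointwise, so each step carries at most the [p]-mass of [A] out of [S]. *)
Lemma escape_mass_le (R : realType) (T : finType) (P : T -> T -> R)
    (p : T -> R) (S A : {set T}) (t : nat) :
  (forall x, 0 <= p x) -> (forall x y, 0 <= P x y) ->
  (forall x, \sum_y P x y = 1) -> (forall y, \sum_x p x * P x y = p y) ->
  (forall x y, x \in S -> y \notin S -> P x y != 0 -> x \in A) ->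
  \sum_(x in S) p x * (\sum_(y in ~: S) kernel_power P t x y) <=
    t%:R * \sum_(x in A) p x.
Proof.
move=> p0 P0 P1 pP exitS.
pose g t z := \sum_(x in S) p x * kernel_power P t x z.
have gE u : \sum_(x in S) p x * (\sum_(y in ~: S) kernel_power P u x y) =
    \sum_(y in ~: S) g u y.
  under eq_bigr do rewrite mulr_sumr.
  by rewrite exchange_big.
have g0 u z : 0 <= g u z.
  by apply: sumr_ge0 => x _; rewrite mulr_ge0 ?kernel_power_ge0.
have gp u z : g u z <= p z.
  rewrite -(stationary_kernel_power u z pP) [leRHS](bigID (mem S)) /= lerDl.
  by apply: sumr_ge0 => x _; rewrite mulr_ge0 ?kernel_power_ge0.
have out1 z : \sum_(y in ~: S) P z y <= 1.
  rewrite -(P1 z) [leRHS](bigID (mem (~: S))) /= lerDl.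
  exact: sumr_ge0.
rewrite gE; elim: t => [|t IH].
  rewrite mul0r big1 // => y; rewrite inE => yS.
  rewrite /g big1 // => x xS /=.
  by case: eqP => [yx|_]; [rewrite yx xS in yS | rewrite mulr0].
have -> : \sum_(y in ~: S) g t.+1 y = \sum_z g t z * \sum_(y in ~: S) P z y.
  under [RHS]eq_bigr do rewrite mulr_sumr.
  rewrite [RHS]exchange_big /=; apply: eq_bigr => y _.
  under [RHS]eq_bigr do rewrite mulr_suml.
  rewrite [RHS]exchange_big /=; apply: eq_bigr => x _; rewrite mulr_sumr.
  by apply: eq_bigr => z _; rewrite mulrA.
(* States already outside [S] contribute at most the previous outside mass; among the states of [S]
   only those in [A] contribute. *)
rewrite -natr1 mulrDl mul1r addrC (bigID (mem S)) /= lerD //; last first.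
  apply: le_trans IH.
  rewrite [leRHS](eq_bigl (fun z => z \notin S)); last by move=> z; rewrite inE.
  by apply: ler_sum => z _; rewrite ler_piMr.
rewrite [leLHS](bigID (mem A)) /= [X in _ + X]big1 ?addr0; last first.
  move=> z /andP[zS zA]; rewrite big1 ?mulr0 // => y; rewrite inE => yS.
  by apply/eqP; apply: contraNT zA; exact: exitS.
rewrite big_mkcondl /=.
apply: ler_sum => z zA; case: ifP => // _.
by rewrite -[leRHS]mulr1 ler_pM // sumr_ge0.
Qed.

Lemma tv_dist_ge (R : realType) (T : finType) (mu nu : T -> R) (A : {set T}) :
  `|\sum_(x in A) mu x - \sum_(x in A) nu x| <= tv_dist mu nu.
Proof. exact: le_bigmax. Qed.

Lemma gibbs_weight_gt0 (R : realType) (lambda J beta : R) (q m N : nat)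
    (sigma : config q m N) : 0 < gibbs_weight lambda J beta sigma.
Proof. exact: expR_gt0. Qed.

Lemma partition_function_gt0 (R : realType) (lambda J beta : R) (q m N : nat) :
  (0 < q)%N -> 0 < partition_function lambda J beta q m N.
Proof.
move=> q0; rewrite /partition_function (bigD1 [ffun=> Ordinal q0]) //=.
by rewrite ltr_pwDl ?gibbs_weight_gt0 // sumr_ge0 // => s _;
  rewrite ltW ?gibbs_weight_gt0.
Qed.

Lemma gibbs_gt0 (R : realType) (lambda J beta : R) (q m N : nat)
    (sigma : config q m N) : (0 < q)%N -> 0 < gibbs lambda J beta sigma.
Proof.
move=> q0; apply: divr_gt0; first exact: gibbs_weight_gt0.
exact: partition_function_gt0.
Qed.

Lemma sum_gibbs (R : realType) (lambda J beta : R) (q m N : nat) : (0 < q)%N ->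
  \sum_(sigma : config q m N) gibbs lambda J beta sigma = 1.
Proof.
by move=> q0; rewrite /gibbs -mulr_suml divff // gt_eqF ?partition_function_gt0.
Qed.

Lemma agree_off_refl (q m N : nat) (v : vertex m N) (sigma : config q m N) :
  agree_off v sigma sigma.
Proof. by apply/forallP => w; rewrite eqxx implybT. Qed.

Lemma agree_off_sym (q m N : nat) (v : vertex m N) (sigma tau : config q m N) :
  agree_off v sigma tau = agree_off v tau sigma.
Proof. by apply: eq_forallb => w; rewrite [tau w == _]eq_sym. Qed.

Lemma agree_off_eql (q m N : nat) (v : vertex m N) (sigma tau : config q m N) :
  agree_off v sigma tau -> agree_off v sigma =1 agree_off v tau.
Proof.
move=> /forallP st eta; apply: eq_forallb => w.
by have := st w; case: (w != v) => //= /eqP ->.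
Qed.

Lemma gibbs_cond_denom_gt0 (R : realType) (lambda J beta : R) (q m N : nat)
    (v : vertex m N) (sigma : config q m N) : (0 < q)%N ->
  0 < \sum_(eta : config q m N | agree_off v sigma eta) gibbs lambda J beta eta.
Proof.
move=> q0; rewrite (bigD1 sigma) ?agree_off_refl //=.
by rewrite ltr_pwDl ?gibbs_gt0 // sumr_ge0 // => s _; rewrite ltW ?gibbs_gt0.
Qed.

Lemma gibbs_cond_ge0 (R : realType) (lambda J beta : R) (q m N : nat)
    (v : vertex m N) (sigma tau : config q m N) : (0 < q)%N ->
  0 <= gibbs_cond lambda J beta v sigma tau.
Proof.
move=> q0; rewrite /gibbs_cond divr_ge0 //;
  last by rewrite ltW ?gibbs_cond_denom_gt0.
by case: ifP => // _; rewrite ltW ?gibbs_gt0.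
Qed.

Lemma glauber_kernel_ge0 (R : realType) (lambda J beta : R) (q m N : nat)
    (sigma tau : config q m N) : (0 < q)%N ->
  0 <= glauber_kernel lambda J beta sigma tau.
Proof.
by move=> q0; apply: sumr_ge0 => v _;
  rewrite mulr_ge0 ?invr_ge0 ?ler0n ?gibbs_cond_ge0.
Qed.

Lemma sum_glauber_kernel (R : realType) (lambda J beta : R) (q m N : nat)
    (sigma : config q m N) : (0 < q)%N -> (0 < m)%N -> (0 < N)%N ->
  \sum_tau glauber_kernel lambda J beta sigma tau = 1.
Proof.
move=> q0 m0 N0; rewrite /glauber_kernel exchange_big /=.
under eq_bigr => v _.
  rewrite -mulr_sumr -mulr_suml -big_mkcond /= divff; last first.
    by rewrite gt_eqF ?gibbs_cond_denom_gt0.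
  over.
rewrite sumr_const mulr1 -[LHS]mulr_natr mulVf //.
by rewrite pnatr_eq0 card_prod !card_ord muln_eq0 negb_or -!lt0n m0.
Qed.

(** Agreement off [v] is an equivalence relation, so both conditional laws have the same normalizing
    sum. *)
Lemma glauber_detailed_balance (R : realType) (lambda J beta : R) (q m N : nat)
    (sigma tau : config q m N) :
  gibbs lambda J beta sigma * glauber_kernel lambda J beta sigma tau =
  gibbs lambda J beta tau * glauber_kernel lambda J beta tau sigma.
Proof.
rewrite !mulr_sumr; apply: eq_bigr => v _.
rewrite mulrCA [RHS]mulrCA; congr (_ * _).
rewrite /gibbs_cond -(agree_off_sym v sigma tau); case: ifP => [st|_];
  last first.
  by rewrite !mul0r !mulr0.
by rewrite (eq_bigl _ _ (agree_off_eql st)) mulrCA.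
Qed.

Lemma glauber_stationary (R : realType) (lambda J beta : R) (q m N : nat)
    (tau : config q m N) : (0 < q)%N -> (0 < m)%N -> (0 < N)%N ->
  \sum_sigma gibbs lambda J beta sigma * glauber_kernel lambda J beta sigma tau
    =
  gibbs lambda J beta tau.
Proof.
move=> q0 m0 N0; under eq_bigr do rewrite glauber_detailed_balance.
by rewrite -mulr_sumr sum_glauber_kernel // mulr1.
Qed.

Lemma glauber_kernel_neq0 (R : realType) (lambda J beta : R) (q m N : nat)
    (sigma tau : config q m N) :
  glauber_kernel lambda J beta sigma tau != 0 ->
  exists v, agree_off v sigma tau.
Proof.
apply: contraNP => /forallNP h; apply/eqP; apply: big1 => v _.
by rewrite /gibbs_cond (negPf (introN idP (h v))) mul0r mulr0.
Qed.

(** The complement of [S] has Gibbs mass at least 1/2, so once the distance is at most 1/4 every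
    start puts mass at least 1/4 there. Averaging over the starts in [S] and comparing with
    [escape_mass_le] bounds [t] below. *)
Lemma mixing_time_ge (R : realType) (lambda J beta e : R) (q m N : nat)
    (S A : {set config q m N}) :
  (0 < q)%N -> (0 < m)%N -> (0 < N)%N ->
  (forall v sigma tau, agree_off v sigma tau -> sigma \in S -> tau \notin S ->
    sigma \in A) ->
  0 < \sum_(sigma in S) gibbs lambda J beta sigma <= 1 / 2 ->
  \sum_(sigma in A) gibbs lambda J beta sigma <=
    e * \sum_(sigma in S) gibbs lambda J beta sigma ->
  0 < e ->
  ((1 / (4 * e))%:E <= mixing_time lambda J beta q m N)%E.
Proof.
move=> q0 m0 N0 exitS /andP[S0 S2] AS e0.
apply: le_ereal_inf_tmp => _ [t [t0 dt] <-].
rewrite lee_fin ler_pdivrMr; last by rewrite mulr_gt0.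
have lawE u sigma tau : glauber_law lambda J beta u sigma tau =
    kernel_power (glauber_kernel lambda J beta (N:=N)) u sigma tau.
  by elim: u tau => //= u IH tau; apply: eq_bigr => eta _; rewrite IH.
have esc := @escape_mass_le _ _ _ _ S A t (fun s =>
  ltW (@gibbs_gt0 R lambda J beta q m N s q0))
  (fun s u => @glauber_kernel_ge0 R lambda J beta q m N s u q0)
  (fun s => @sum_glauber_kernel R lambda J beta q m N s q0 m0 N0)
  (fun s => @glauber_stationary R lambda J beta q m N s q0 m0 N0).
have {}esc := esc (fun s u sS uS k =>
  let: ex_intro v hv := glauber_kernel_neq0 k in exitS v s u hv sS uS).
have far sigma : 1 / 4 <= \sum_(tau in ~: S) kernel_power (glauber_kernel
  lambda J beta (N:=N)) t sigma tau.
  under eq_bigr do rewrite -lawE.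
  have h1 : tv_dist (glauber_law lambda J beta t sigma) (gibbs lambda J beta
    (N:=N)) <= 1 / 4.
    by apply: le_trans dt; exact: (le_bigmax _ (fun s =>
      tv_dist (glauber_law lambda J beta t s) (gibbs lambda J beta (N:=N)))).
  have := le_trans (tv_dist_ge _ _ (~: S)) h1.
  have : \sum_(s in ~: S) gibbs lambda J beta s = 1 - \sum_(s in S) gibbs
    lambda J beta s.
    rewrite -(@sum_gibbs R lambda J beta q m N q0) [in RHS](bigID (mem S)) /=
      addrC addrK.
    by apply: eq_bigl => s; rewrite inE.
  move=> ->; rewrite ler_norml => /andP[]; lra.
have : 1 / 4 * \sum_(sigma in S) gibbs lambda J beta sigma <= t%:R * (e *
  \sum_(sigma in S) gibbs lambda J beta sigma).
  apply: le_trans (le_trans esc _).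
    by rewrite mulrC mulr_suml; apply: ler_sum => s _;
      rewrite ler_pM2l ?gibbs_gt0.
  by rewrite ler_wpM2l ?ler0n.
by rewrite mulrA ler_pM2r //; lra.
Qed.

(** * Gibbs weights around a fixed point *)

Definition spin_count (q m N : nat) (sigma : config q m N) (k : 'I_m)
    (j : 'I_q) : nat :=
  \sum_(i < N) (sigma (k, i) == j).

Definition deviation (R : realType) (q m N : nat) (p : 'I_q -> R)
    (sigma : config q m N) (k : 'I_m) (j : 'I_q) : R :=
  (spin_count sigma k j)%:R / N%:R - p j.

Definition sqdev (R : realType) (q m N : nat) (p : 'I_q -> R)
    (sigma : config q m N) : R :=
  \sum_k \sum_j deviation p sigma k j ^+ 2.

Definition iid_weight (R : realType) (q m N : nat) (p : 'I_q -> R)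
    (sigma : config q m N) : R :=
  \prod_v p (sigma v).

Lemma sum_spin (R : realType) (q m N : nat) (f : 'I_m -> 'I_q -> R)
    (sigma : config q m N) :
  \sum_v f v.1 (sigma v) = \sum_k \sum_j f k j * (spin_count sigma k j)%:R.
Proof.
transitivity (\sum_v f v.1 (sigma (v.1, v.2))); first by apply: eq_bigr => -[].
rewrite -(pair_bigA _ (fun k i => f k (sigma (k, i)))) /=.
apply: eq_bigr => k _.
under [RHS]eq_bigr do rewrite natr_sum mulr_sumr.
rewrite [RHS]exchange_big /=; apply: eq_bigr => i _.
rewrite (bigD1 (sigma (k, i))) //= eqxx mulr1 big1 ?addr0 // => j /negPf ji.
by rewrite eq_sym ji mulr0.
Qed.

Lemma sum_spin_count (q m N : nat) (sigma : config q m N) (k : 'I_m) :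
  (\sum_j spin_count sigma k j = N)%N.
Proof.
rewrite exchange_big /= -[RHS]card_ord -sum1_card; apply: eq_bigr => i _.
rewrite (bigD1 (sigma (k, i))) //= eqxx big1 // => j /negPf ji.
by rewrite eq_sym ji.
Qed.

Lemma spin_count_le (q m N : nat) (sigma : config q m N) (k : 'I_m)
    (j : 'I_q) : (spin_count sigma k j <= N)%N.
Proof.
by rewrite -[leqRHS](sum_spin_count sigma k) (bigD1 j) //= leq_addr.
Qed.

(** The coupling is [a] times [(1 - lambda)] on equal components plus [a * lambda] on all pairs; the
    first part sees the counts per component, the second the total counts. *)
Lemma energy_spin_count (R : realType) (lambda J : R) (q m N : nat)
    (sigma : config q m N) :
  \sum_v \sum_w coupling lambda J v w * (sigma v == sigma w)%:R =
  J / (1 + (m%:R - 1) * lambda) *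
  ((1 - lambda) * (\sum_k \sum_j (spin_count sigma k j)%:R ^+ 2) +
   lambda * \sum_j (\sum_k (spin_count sigma k j)%:R) ^+ 2).
Proof.
set a := J / _.
pose n k j : R := (spin_count sigma k j)%:R.
have inner v : \sum_w coupling lambda J v w * (sigma v == sigma w)%:R =
    a * ((1 - lambda) * n v.1 (sigma v) + lambda * \sum_k n k (sigma v)).
  pose f k j := a * ((1 - lambda) * (v.1 == k)%:R + lambda) * (sigma v == j)%:R.
  have -> : \sum_w coupling lambda J v w * (sigma v == sigma w)%:R =
      \sum_w f w.1 (sigma w).
    apply: eq_bigr => w _.
    rewrite /f /coupling -/a; congr (_ * _); by case: eqP => _;
      rewrite ?mulr1 ?mulr0 ?subrK ?add0r ?mulr1 // mulrAC.
  rewrite (sum_spin f) /f.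
  have -> : \sum_k \sum_j a * ((1 - lambda) * (v.1 == k)%:R + lambda) * (sigma
    v == j)%:R * (spin_count sigma k j)%:R =
      \sum_k a * ((1 - lambda) * ((v.1 == k)%:R * n k (sigma v)) + lambda * n k
        (sigma v)).
    apply: eq_bigr => k _; rewrite (bigD1 (sigma v)) //= eqxx mulr1 big1 =>
      [|j /negPf jv].
      by rewrite /n; ring.
    by rewrite [sigma v == j]eq_sym jv mulr0 mul0r.
  rewrite -mulr_sumr big_split /= -!mulr_sumr; congr (_ * (_ * _ + _)).
  rewrite (bigD1 v.1) //= eqxx mul1r big1 ?addr0 // => k /negPf kv.
  by rewrite eq_sym kv mul0r.
under eq_bigr do rewrite inner.
rewrite (sum_spin (fun k j =>
  a * ((1 - lambda) * n k j + lambda * \sum_l n l j))).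
have -> : \sum_k \sum_j a * ((1 - lambda) * n k j + lambda * (\sum_l n l j)) *
  (spin_count sigma k j)%:R =
   \sum_k \sum_j (a * (1 - lambda) * n k j ^+ 2 + a * lambda * ((\sum_l n l j)
     * n k j)).
  by apply: eq_bigr => k _; apply: eq_bigr => j _; rewrite /n; ring.
under eq_bigr do rewrite big_split /= -!mulr_sumr.
rewrite big_split /= -!mulr_sumr [RHS]mulrDr !mulrA; congr (_ + _ * _).
rewrite exchange_big /=; apply: eq_bigr => j _.
by rewrite -mulr_sumr expr2.
Qed.

(** Cauchy-Schwarz, by expanding the double sum of [(y k - y l) ^+ 2]. *)
Lemma sqr_sum_le (R : realType) (I : finType) (P : pred I) (y : I -> R) :
  (\sum_(k | P k) y k) ^+ 2 <= #|P|%:R * \sum_(k | P k) y k ^+ 2.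
Proof.
have : 0 <= \sum_(k | P k) \sum_(l | P l) (y k - y l) ^+ 2.
  by apply: sumr_ge0 => k _; apply: sumr_ge0 => l _; exact: sqr_ge0.
have -> : \sum_(k | P k) \sum_(l | P l) (y k - y l) ^+ 2 =
    \sum_(k | P k) (#|P|%:R * y k ^+ 2 - 2 * y k * (\sum_(l | P l) y l) +
      \sum_(l | P l) y l ^+ 2).
  apply: eq_bigr => k _.
  have -> : #|P|%:R * y k ^+ 2 = \sum_(l | P l) y k ^+ 2.
    by rewrite sumr_const mulr_natl.
  rewrite mulr_sumr -sumrB -big_split /=; apply: eq_bigr => l _; ring.
rewrite big_split sumrB /= sumr_const -!mulr_suml -!mulr_sumr -mulr_natl.
by rewrite expr2; lra.
Qed.

(** Expand the energy around [p]. The fixed-point equation makes the linear part the logarithm of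
    the product weight up to a constant, and only the quadratic part [E] remains to be bounded. *)
Lemma gibbs_weight_product (R : realType) (lambda J beta C : R) (q m N : nat)
    (p : 'I_q -> R) :
  (0 < N)%N -> (0 < m)%N -> 0 < lambda -> lambda < 1 -> 0 < J -> 0 < beta ->
  0 < C -> (forall j, p j = C * expR (2 * (beta * J) * p j)) ->
  exists2 K : R, 0 < K & forall sigma : config q m N,
    K * iid_weight p sigma <= gibbs_weight lambda J beta sigma /\
    gibbs_weight lambda J beta sigma <=
      K * (iid_weight p sigma * expR (N%:R * (beta * J) * sqdev p sigma)).
Proof.
move=> N0 m0 l0 l1 J0 b0 C0 pE.
have NR : 0 < N%:R :> R by rewrite ltr0n.
have mR : 1 <= m%:R :> R by rewrite ler1n.
pose B := beta * J.
pose d := 1 + (m%:R - 1) * lambda.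
have d0 : 0 < d by rewrite /d; nra.
pose P2 := \sum_j p j ^+ 2.
(* Below, the constant and linear parts of the exponent sum to [N * B * (2 * L + m * P2)], while the
   product weight accounts for [N * B * (2 * L + 2 * m * P2)]. *)
pose K := expR (- (N%:R * B * m%:R * P2)) * (C ^+ #|vertex m N|)^-1.
exists K; first by rewrite mulr_gt0 ?expR_gt0 // invr_gt0 exprn_gt0.
move=> sigma.
pose y := deviation p sigma.
pose E := beta * J / d * ((1 - lambda) * sqdev p sigma + lambda * \sum_j
  (\sum_k y k j) ^+ 2).
have nE k j : (spin_count sigma k j)%:R = N%:R * (y k j + p j).
  by rewrite /y /deviation; field; lra.
have iidE : expR (\sum_v 2 * B * p (sigma v)) = (C ^+ #|vertex m N|)^-1 *
  iid_weight p sigma.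
  rewrite expR_sum /iid_weight -prodr_const -prodfV -big_split /=.
  by apply: eq_bigr => v _; rewrite [in RHS]pE mulKf // gt_eqF.
pose L := \sum_j p j * \sum_k y k j.
have linE : \sum_v 2 * B * p (sigma v) = N%:R * (2 * B * (L + m%:R * P2)).
  rewrite (sum_spin (fun _ j => 2 * B * p j)).
  have -> : \sum_k \sum_j 2 * B * p j * (spin_count sigma k j)%:R =
      \sum_k N%:R * (2 * B * (\sum_j p j * y k j + P2)).
    apply: eq_bigr => k _; rewrite /P2 -big_split /= !mulr_sumr.
    by apply: eq_bigr => j _; rewrite nE; ring.
  rewrite -!mulr_sumr big_split /= sumr_const card_ord -(mulr_natl P2);
    congr (_ * (_ * (_ + _))).
  by rewrite exchange_big /=; apply: eq_bigr => j _; rewrite mulr_sumr.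
have sqE : \sum_k \sum_j (spin_count sigma k j)%:R ^+ 2 =
    N%:R ^+ 2 * (sqdev p sigma + 2 * L + m%:R * P2) :> R.
  have -> : \sum_k \sum_j (spin_count sigma k j)%:R ^+ 2 =
      \sum_k N%:R ^+ 2 * (\sum_j y k j ^+ 2 + 2 * (\sum_j p j * y k j) + P2) :>
        R.
    apply: eq_bigr => k _; rewrite /P2 !mulr_sumr -!big_split /= mulr_sumr.
    by apply: eq_bigr => j _; rewrite nE; ring.
  rewrite -!mulr_sumr !big_split /= sumr_const card_ord -(mulr_natl P2)
    -mulr_sumr; congr (_ * (_ + _ * _ + _)).
  by rewrite exchange_big /=; apply: eq_bigr => j _; rewrite mulr_sumr.
have colE : \sum_j (\sum_k (spin_count sigma k j)%:R) ^+ 2 =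
    N%:R ^+ 2 * (\sum_j (\sum_k y k j) ^+ 2 + 2 * m%:R * L + m%:R ^+ 2 * P2) :>
      R.
  rewrite /L /P2 !mulr_sumr -!big_split /= mulr_sumr; apply: eq_bigr => j _.
  under eq_bigr do rewrite nE.
  rewrite -mulr_sumr big_split /= sumr_const card_ord -mulr_natl; ring.
have wE : gibbs_weight lambda J beta sigma = K * (iid_weight p sigma * expR
  (N%:R * E)).
  rewrite /gibbs_weight energy_spin_count -/d sqE colE.
  rewrite /K [RHS]mulrA -[_ * _ * iid_weight _ _]mulrA -iidE -!expRD;
    congr expR.
  rewrite linE /E -/d /B.
  by rewrite /d; field; rewrite !gt_eqF.
have iid0 : 0 < iid_weight p sigma.
  by apply: prodr_gt0 => v _; rewrite pE mulr_gt0 ?expR_gt0.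
have K0 : 0 < K by rewrite mulr_gt0 ?expR_gt0 // invr_gt0 exprn_gt0.
have S0 : 0 <= sqdev p sigma.
  by apply: sumr_ge0 => k _; apply: sumr_ge0 => j _; exact: sqr_ge0.
have T0 : 0 <= \sum_j (\sum_k y k j) ^+ 2 by apply: sumr_ge0 => j _;
  exact: sqr_ge0.
have T1 : \sum_j (\sum_k y k j) ^+ 2 <= m%:R * sqdev p sigma.
  rewrite /sqdev exchange_big mulr_sumr /=.
  apply: ler_sum => j _; apply: (le_trans (sqr_sum_le _ _)).
  by rewrite card_ord.
have a0 : 0 < beta * J / d by rewrite !mulr_gt0 ?invr_gt0.
have l1' : 0 <= 1 - lambda by lra.
have E0 : 0 <= E by rewrite /E (mulr_ge0 (ltW a0)) // addr_ge0 // mulr_ge0 //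
  ltW.
(* By [T1] the bracket in [E] is at most [((1 - lambda) + lambda * m) * sqdev], and that coefficient
   is the normalization [d]. *)
have E1 : E <= B * sqdev p sigma.
  have -> : B * sqdev p sigma = B / d * (d * sqdev p sigma) by field; lra.
  by rewrite ler_pM2l // /d; nra.
rewrite wE; split; rewrite ler_pM2l //.
  by rewrite ler_peMr ?(ltW iid0) // -[leLHS]expR0 ler_expR mulr_ge0.
by rewrite ler_pM2l // ler_expR -mulrA ler_pM2l.
Qed.

(** * Large deviations of the spin counts *)

Lemma iid_weight_ge0 (R : realType) (q m N : nat) (p : 'I_q -> R)
    (sigma : config q m N) : (forall j, 0 <= p j) -> 0 <= iid_weight p sigma.
Proof. by move=> p0; apply: prodr_ge0. Qed.

Lemma sum_iid_weight (R : realType) (q m N : nat) (p : 'I_q -> R) :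
  \sum_j p j = 1 -> \sum_(sigma : config q m N) iid_weight p sigma = 1.
Proof.
move=> p1; rewrite -(bigA_distr_bigA (fun (_ : vertex m N) j => p j)) /=.
by rewrite big1.
Qed.

(** Exponential Markov inequality; the moment generating function factors over the vertices. *)
Lemma chernoff (R : realType) (q m N : nat) (p : 'I_q -> R)
    (theta : 'I_m -> 'I_q -> R) (b : R) (P : pred (config q m N)) :
  (forall j, 0 <= p j) ->
  (forall sigma, P sigma ->
     b <= \sum_k \sum_j theta k j * (spin_count sigma k j)%:R) ->
  \sum_(sigma | P sigma) iid_weight p sigma <=
    expR (- b) * \prod_k (\sum_j p j * expR (theta k j)) ^+ N.
Proof.
move=> p0 hb.
have -> : \prod_k (\sum_j p j * expR (theta k j)) ^+ N =
    \sum_(sigma : config q m N) \prod_v (p (sigma v) * expR (theta v.1 (sigma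
      v))).
  rewrite -(bigA_distr_bigA (fun (v : vertex m N) j =>
    p j * expR (theta v.1 j))) /=.
  rewrite -(pair_bigA _ (fun k (_ : 'I_N) => \sum_j p j * expR (theta k j))) /=.
  by apply: eq_bigr => k _; rewrite prodr_const card_ord.
rewrite mulr_sumr [leRHS](bigID P) /= -[leLHS]addr0 lerD //; last first.
  apply: sumr_ge0 => s _; rewrite mulr_ge0 ?expR_ge0 // prodr_ge0 // => v _.
  by rewrite mulr_ge0 ?expR_ge0.
apply: ler_sum => s Ps.
rewrite big_split /= -expR_sum (sum_spin theta) mulrCA -expRD ler_peMr
  ?iid_weight_ge0 //.
by rewrite -[leLHS]expR0 ler_expR addrC subr_ge0 hb.
Qed.

Lemma sum_cover_le (R : realType) (T I : finType) (w : T -> R) (P : pred T)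
    (Q : I -> pred T) :
  (forall x, 0 <= w x) -> (forall x, P x -> exists i, Q i x) ->
  \sum_(x | P x) w x <= \sum_i \sum_(x | Q i x) w x.
Proof.
move=> w0 PQ; under [leRHS]eq_bigr do rewrite big_mkcond /=.
rewrite exchange_big big_mkcond /=; apply: ler_sum => x _.
have ge0 : 0 <= \sum_i (if Q i x then w x else 0).
  by apply: sumr_ge0 => i _; case: ifP.
case: ifP => // Px; have [i Qi] := PQ x Px.
rewrite (bigD1 i) //= Qi lerDl.
by apply: sumr_ge0 => i' _; case: ifP.
Qed.

Lemma sum_deviation (R : realType) (q m N : nat) (p : 'I_q -> R)
    (sigma : config q m N) (k : 'I_m) : (0 < N)%N -> \sum_j p j = 1 ->
  \sum_j deviation p sigma k j = 0.
Proof.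
move=> N0 p1; rewrite /deviation sumrB p1 -mulr_suml -natr_sum sum_spin_count.
by rewrite divff ?subrr // pnatr_eq0 -lt0n.
Qed.

Lemma deviation_tail (R : realType) (q m N : nat) (p : 'I_q -> R) (k : 'I_m)
    (j : 'I_q) (sg e a : R) :
  (0 < N)%N -> (forall j, 0 <= p j) -> \sum_j p j = 1 -> `|sg| <= 1 ->
  0 < e -> (forall t, `|t| <= e -> expR t <= 1 + t + t ^+ 2) ->
  \sum_(sigma : config q m N | a <= sg * deviation p sigma k j)
    iid_weight p sigma <= expR (- (e * (a - e) * N%:R)).
Proof.
move=> N0 p0 p1 sg1 e0 he.
have NR : 0 < N%:R :> R by rewrite ltr0n.
(* Tilting only the coordinate [(k, j)]; the sign [sg] serves both tails. *)
pose theta k' j' : R := if (k' == k) && (j' == j) then sg * e else 0.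
have thetaE f : \sum_k' \sum_j' theta k' j' * f k' j' = sg * e * f k j.
  rewrite (bigD1 k) //= (bigD1 j) //= /theta !eqxx /= big1 ?addr0; last first.
    by move=> j' /negPf ->; rewrite mul0r.
  rewrite big1 ?addr0 // => k' /negPf kk; rewrite big1 // => j' _.
  by rewrite kk mul0r.
apply: (le_trans (@chernoff R q m N p theta (N%:R * (sg * e * p j + e * a)) _
  p0 _)).
  move=> s; rewrite thetaE => hs.
  have -> : (spin_count s k j)%:R = N%:R * (deviation p s k j + p j).
    by rewrite /deviation; field; lra.
  have : N%:R * e * a <= N%:R * e * (sg * deviation p s k j).
    by rewrite ler_pM2l ?mulr_gt0.
  by nra.
have col k' : 0 <= \sum_j' p j' * expR (theta k' j') <=
    (if k' == k then expR (sg * e * p j + e ^+ 2) else 1).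
  apply/andP; split; first by apply: sumr_ge0 => j' _;
    rewrite mulr_ge0 ?expR_ge0.
  case: (altP (k' =P k)) => kk; last first.
    rewrite -[leRHS]p1; apply: ler_sum => j' _.
    by rewrite /theta (negPf kk) expR0 mulr1.
  apply: le_trans (expR_ge1Dx _).
  have -> : 1 + (sg * e * p j + e ^+ 2) = \sum_j' p j' * (1 + theta k' j' + e
    ^+ 2).
    have pth : \sum_j' p j' * theta k' j' = sg * e * p j.
      rewrite (bigD1 j) //= big1 => [|j' /negPf jj].
        by rewrite /theta kk !eqxx /=; ring.
      by rewrite /theta jj andbF mulr0.
    under eq_bigr do rewrite mulrDr mulrDr mulr1.
    by rewrite !big_split /= -mulr_suml p1 pth mul1r addrA.
  apply: ler_sum => j' _; rewrite ler_wpM2l //.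
  have th : `|theta k' j'| <= e.
    rewrite /theta; case: ifP => _; last by rewrite normr0 ltW.
    by rewrite normrM (gtr0_norm e0) ler_piMl // ltW.
  apply: (le_trans (he _ th)); rewrite lerD2l.
  by rewrite -ler_sqrt ?sqr_ge0 // !sqrtr_sqr (gtr0_norm e0).
have prodle : \prod_k' (\sum_j' p j' * expR (theta k' j')) ^+ N <= expR (sg * e
  * p j + e ^+ 2) ^+ N.
  rewrite prodrXl lerXn2r // ?nnegrE ?expR_ge0 //.
    by apply: prodr_ge0 => k' _; case/andP: (col k').
  apply: (@le_trans _ _ (\prod_k' (if k' == k then expR (sg * e * p j + e ^+ 2)
    else 1))).
    by apply: ler_prod => k' _; exact: col.
  by rewrite (bigD1 k) //= eqxx big1 ?mulr1 // => k' /negPf ->.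
apply: (le_trans (ler_wpM2l (expR_ge0 _) prodle)).
rewrite -expRM_natl -expRD ler_expR; rewrite le_eqVlt; apply/predU1P; left;
  ring.
Qed.

(** Union bound over the [m * q] coordinates and two signs: if every deviation is below [a] in
    absolute value, then [sqdev <= m * q * a ^+ 2 <= delta ^+ 2]. *)
Lemma sqdev_tail (R : realType) (q m : nat) (p : 'I_q -> R) (delta : R) :
  (0 < q)%N -> (0 < m)%N -> (forall j, 0 <= p j) -> \sum_j p j = 1 ->
  0 < delta ->
  exists2 c : R, 0 < c & forall N : nat, (0 < N)%N ->
    \sum_(sigma : config q m N | delta ^+ 2 < sqdev p sigma)
      iid_weight p sigma <= 2 * m%:R * q%:R * expR (- (c * N%:R)).
Proof.
move=> q0 m0 p0 p1 delta0.
have qR : 1 <= q%:R :> R by rewrite ler1n.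
have mR : 1 <= m%:R :> R by rewrite ler1n.
have mq1 : 1 <= m%:R * q%:R :> R by rewrite -natrM ler1n muln_gt0 m0.
pose a := delta / (m%:R * q%:R).
have a0 : 0 < a by rewrite divr_gt0 //; lra.
have [d d0 hd] := @expR_le_quadratic R (1 / 2) ltac:(lra).
(* The bound [a / 2] keeps the rate [e * (a - e)] positive; the bound [d] gives access to the
   quadratic estimate. *)
pose e := Num.min d (a / 2).
have e0 : 0 < e by rewrite lt_min d0 divr_gt0.
have ea : e <= a / 2 by rewrite ge_min lexx orbT.
exists (e * (a - e)) => [|N N0]; first by rewrite mulr_gt0 //; lra.
pose sg (b : bool) : R := if b then 1 else - 1.
apply: (le_trans (@sum_cover_le R _ ('I_m * 'I_q * bool)%type (iid_weight p) _
   (fun i sigma => a <= sg i.2 * deviation p sigma i.1.1 i.1.2) _ _)).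
- by move=> s; exact: iid_weight_ge0.
- move=> s; apply: contraPP => /forallNP hs; apply/negP; rewrite -leNgt.
  have ya k j : deviation p s k j ^+ 2 <= a ^+ 2.
    have := hs (k, j, true); have := hs (k, j, false); rewrite /sg /=.
    by move=> /negP; rewrite -ltNge => h1 /negP; rewrite -ltNge => h2; nra.
  apply: (@le_trans _ _ (\sum_(k < m) \sum_(j < q) a ^+ 2)).
    by apply: ler_sum => k _; apply: ler_sum => j _; exact: ya.
  rewrite !sumr_const !card_ord -(mulr_natl (a ^+ 2)) -(mulr_natl (_ * _))
    mulrA.
  have -> : delta = m%:R * q%:R * a by rewrite /a; field; lra.
  by nra.
apply: (@le_trans _ _ (\sum_(i : 'I_m * 'I_q * bool) expR (- (e * (a - e) *
  N%:R)))).
  apply: ler_sum => i _; apply: deviation_tail => //.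
    by rewrite /sg; case: i.2; rewrite ?normrN normr1.
  move=> t te; apply: (le_trans (hd t _)); first by apply: (le_trans te);
    rewrite ge_min lexx.
  by rewrite lerD2l; have := sqr_ge0 t; nra.
rewrite sumr_const !card_prod !card_ord card_bool -(mulr_natl (expR _)) !natrM.
by rewrite le_eqVlt; apply/predU1P; left; ring.
Qed.

(** For fixed counts, tilting by [y / p] bounds the product mass by
    [expR (- N * (1/2 - kappa * r / 2) * Q0)]. The quadratic form gains [kappa * sqdev] over the
    energy; the error of the tilt costs at most half of it, and [sqdev >= delta ^+ 2 / 2] on the
    shell. *)
Lemma sqdev_shell (R : realType) (q m : nat) (p : 'I_q -> R) (r B kappa : R) :
  0 < r -> (forall j, r <= p j) -> \sum_j p j = 1 -> 0 < kappa ->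
  (forall y : 'I_q -> R, \sum_j y j = 0 ->
     (B + kappa) * \sum_j y j ^+ 2 <= 1 / 2 * \sum_j y j ^+ 2 / p j) ->
  exists2 d : R, 0 < d & forall (delta : R) (N : nat),
    0 < delta -> delta <= d -> (0 < N)%N ->
    \sum_(sigma : config q m N |
        delta ^+ 2 / 2 <= sqdev p sigma <= delta ^+ 2)
      iid_weight p sigma * expR (N%:R * B * sqdev p sigma) <=
    N.+1%:R ^+ (m * q) * expR (- (kappa * delta ^+ 2 / 4 * N%:R)).
Proof.
move=> r0 rp p1 kappa0 form.
have pp j : 0 < p j by apply: lt_le_trans (rp j).
have [d d0 hd] := @expR_le_quadratic R (kappa * r / 2) ltac:
  (by rewrite !mulr_gt0).
(* Every deviation is then at most [d * r], and dividing by [p j >= r] gives a tilt of size at most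
   [d]. *)
exists (d * r) => [|delta N delta0 deltad N0]; first by rewrite mulr_gt0.
have NR : 0 < N%:R :> R by rewrite ltr0n.
pose P (s : config q m N) := delta ^+ 2 / 2 <= sqdev p s <= delta ^+ 2.
(* [f] prescribes all the spin counts, which leaves [N.+1 ^ (m * q)] classes. *)
pose Q (f : {ffun 'I_m * 'I_q -> 'I_N.+1}) (s : config q m N) :=
  P s && [forall k, forall j, f (k, j) == spin_count s k j :> nat].
apply: (le_trans (@sum_cover_le R _ {ffun 'I_m * 'I_q -> 'I_N.+1}
   (fun s => iid_weight p s * expR (N%:R * B * sqdev p s)) P Q _ _)).
- by move=> s; rewrite mulr_ge0 ?expR_ge0 ?iid_weight_ge0 // => j; rewrite ltW.
- move=> s Ps; exists [ffun x => inord (spin_count s x.1 x.2)].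
  rewrite /Q Ps; apply/forallP => k; apply/forallP => j.
  by rewrite ffunE inordK // ltnS spin_count_le.
apply: (@le_trans _ _ (\sum_(f : {ffun 'I_m * 'I_q -> 'I_N.+1}) expR (- (kappa
  * delta ^+ 2 / 4 * N%:R)))); last first.
  by rewrite sumr_const card_ffun card_prod !card_ord -(mulr_natl (expR _))
    natrX.
apply: ler_sum => f _.
case: (pickP (Q f)) => [s0 Qs0|Q0]; last by rewrite big_pred0 ?expR_ge0.
have [/andP[Ps0l Ps0r] cs0] : P s0 /\ forall k j, f (k,
  j) = spin_count s0 k j :> nat.
  by case/andP: Qs0 => ? /forallP h; split => // k j; apply/eqP;
    move/forallP: (h k).
have cs s : Q f s -> forall k j, spin_count s k j = spin_count s0 k j.
  case/andP=> _ /forallP h k j; rewrite -cs0; apply/esym/eqP;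
    by move/forallP: (h k).
pose y := deviation p s0.
(* First-order approximation of the optimal tilt [ln ((p j + y k j) / p j)]; its mean under [p]
   vanishes because the deviations sum to 0. *)
pose theta k j := y k j / p j.
pose Q0 := \sum_k \sum_j y k j ^+ 2 / p j.
have y0 k : \sum_j y k j = 0 by exact: sum_deviation.
have yd k j : `|y k j| <= d * r.
  have dr : 0 <= d * r by rewrite ltW // mulr_gt0.
  rewrite -[d * r]ger0_norm // -!sqrtr_sqr ler_sqrt ?sqr_ge0 //.
  apply: (@le_trans _ _ (delta ^+ 2)); last by nra.
  apply: (le_trans _ Ps0r); rewrite /sqdev (bigD1 k) //= (bigD1 j) //= -addrA
    lerDl.
  by rewrite addr_ge0 // sumr_ge0 // => i _; rewrite ?sumr_ge0 // => *;
    rewrite sqr_ge0.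
have thd k j : `|theta k j| <= d.
  rewrite /theta normrM normfV (gtr0_norm (pp j)) ler_pdivrMr //.
  by apply: (le_trans (yd k j)); rewrite ler_pM2l.
have thN : \sum_k \sum_j theta k j * (spin_count s0 k j)%:R = N%:R * Q0.
  rewrite mulr_sumr; apply: eq_bigr => k _.
  transitivity (N%:R * (\sum_j y k j ^+ 2 / p j + \sum_j y k j));
    last by rewrite y0 addr0.
  rewrite -big_split mulr_sumr /=.
  apply: eq_bigr => j _.
  have -> : (spin_count s0 k j)%:R = N%:R * (y k j + p j).
    by rewrite /y /deviation; field; lra.
  by rewrite /theta; field; rewrite gt_eqF.
have mgf k : \sum_j p j * expR (theta k j) <= expR ((1 / 2 + kappa * r / 2) *
  \sum_j y k j ^+ 2 / p j).
  apply: le_trans (expR_ge1Dx _).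
  have -> : 1 + (1 / 2 + kappa * r / 2) * (\sum_j y k j ^+ 2 / p j) =
      \sum_j p j * (1 + theta k j + (1 / 2 + kappa * r / 2) * theta k j ^+ 2).
    transitivity (\sum_j p j + \sum_j y k j + (1 / 2 + kappa * r / 2) * (\sum_j
      y k j ^+ 2 / p j)).
      by rewrite p1 y0 addr0.
    rewrite mulr_sumr -!big_split /=.
    by apply: eq_bigr => j _; rewrite /theta; field; rewrite gt_eqF.
  by apply: ler_sum => j _; rewrite ler_pM2l // hd.
have prodle : \prod_k (\sum_j p j * expR (theta k j)) ^+ N <= expR (N%:R * ((1
  / 2 + kappa * r / 2) * Q0)).
  rewrite prodrXl expRM_natl lerXn2r ?nnegrE ?expR_ge0 //.
    by apply: prodr_ge0 => k _; apply: sumr_ge0 => j _;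
      rewrite mulr_ge0 ?expR_ge0 ?ltW.
  rewrite mulr_sumr expR_sum; apply: ler_prod => k _; rewrite mgf andbT.
  by apply: sumr_ge0 => j _; rewrite mulr_ge0 ?expR_ge0 ?ltW.
have sqE s : Q f s -> sqdev p s = sqdev p s0.
  move=> /cs h; apply: eq_bigr => k _; apply: eq_bigr => j _.
  by rewrite /deviation h.
rewrite (eq_bigr (fun s => iid_weight p s * expR (N%:R * B * sqdev p s0)));
  last first.
  by move=> s /sqE ->.
rewrite -mulr_suml.
have ch : \sum_(s | Q f s) iid_weight p s <= expR (- (N%:R * Q0)) * expR (N%:R
  * ((1 / 2 + kappa * r / 2) * Q0)).
  apply: (le_trans (@chernoff R q m N p theta (N%:R * Q0) (Q f) _ _)).
  - by move=> j; rewrite ltW.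
  - move=> s /cs h; rewrite -thN le_eqVlt; apply/predU1P; left.
    by apply: eq_bigr => k _; apply: eq_bigr => j _; rewrite h.
  by rewrite ler_wpM2l ?expR_ge0.
apply: (le_trans (ler_wpM2r (expR_ge0 _) ch)).
rewrite -!expRD ler_expR.
have F : (B + kappa) * sqdev p s0 <= 1 / 2 * Q0.
  by rewrite /sqdev /Q0 !mulr_sumr; apply: ler_sum => k _; exact: form.
have F2 : r * Q0 <= sqdev p s0.
  rewrite /sqdev /Q0 !mulr_sumr; apply: ler_sum => k _; rewrite mulr_sumr.
  apply: ler_sum => j _; rewrite mulrCA ler_piMr ?sqr_ge0 //.
  by rewrite ler_pdivrMr // mul1r.
have -> : - (kappa * delta ^+ 2 / 4 * N%:R) = N%:R * (- (kappa / 2 * (delta ^+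
  2 / 2))) by field.
have -> : - (N%:R * Q0) + N%:R * ((1 / 2 + kappa * r / 2) * Q0) + N%:R * B *
  sqdev p s0 =
   N%:R * (B * sqdev p s0 - 1 / 2 * Q0 + kappa / 2 * (r * Q0)) by field.
rewrite ler_pM2l //.
have : kappa / 2 * (r * Q0) <= kappa / 2 * sqdev p s0
  by rewrite ler_pM2l // divr_gt0.
have : kappa / 2 * (delta ^+ 2 / 2) <= kappa / 2 * sqdev p s0
  by rewrite ler_pM2l // divr_gt0.
lra.
Qed.

(** After multiplication by [2 * q * s * t], the relation [s + (q - 1) * t = 1] reduces the bound to
    [(s - t) * y j0 ^+ 2 <= (s - t) * (q - 1) * Q], which is Cauchy-Schwarz on the other
    coordinates. *)
Lemma stable_quadratic_form (R : realType) (q : nat) (j0 : 'I_q) (s t B : R) :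
  0 < t -> t < s -> s + (q%:R - 1) * t = 1 -> 2 * B * q%:R * s * t < 1 ->
  exists2 kappa : R, 0 < kappa & forall y : 'I_q -> R, \sum_j y j = 0 ->
    (B + kappa) * \sum_j y j ^+ 2 <=
      1 / 2 * \sum_j y j ^+ 2 / (if j == j0 then s else t).
Proof.
move=> t0 ts st1 hB.
have s0 : 0 < s by lra.
have q0 : 1 <= q%:R :> R by rewrite ler1n (leq_trans _ (ltn_ord j0)).
have st0 : 0 < 2 * q%:R * s * t by rewrite !mulr_gt0 //; lra.
exists ((2 * q%:R * s * t)^-1 - B).
  rewrite subr_gt0 -div1r ltr_pdivlMr //; lra.
move=> y ys.
have -> : B + ((2 * q%:R * s * t)^-1 - B) = (2 * q%:R * s * t)^-1 by ring.
rewrite (bigD1 j0) //= [X in 1 / 2 * X](bigD1 j0) //= eqxx.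
set Q := \sum_(j | j != j0) y j ^+ 2.
have -> : \sum_(j | j != j0) y j ^+ 2 / (if j == j0 then s else t) = Q / t.
  by rewrite mulr_suml; apply: eq_bigr => j /negPf ->.
have sy : \sum_(j | j != j0) y j = - y j0.
  by move: ys; rewrite (bigD1 j0) //=; lra.
have CS : y j0 ^+ 2 <= (q%:R - 1) * Q.
  rewrite -sqrrN -sy; apply: (le_trans (sqr_sum_le _ _)).
  have -> : #|[pred j | j != j0]| = q.-1
    by rewrite -[in RHS](card_ord q) -(cardC1 j0).
  by rewrite -subn1 natrB // (leq_trans _ (ltn_ord j0)).
have q1 : 0 <= q%:R - 1 :> R by lra.
rewrite -(ler_pM2l st0) mulVKf ?gt_eqF //.
have -> : 2 * q%:R * s * t * (1 / 2 * (y j0 ^+ 2 / s + Q / t)) = q%:R * t * y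
  j0 ^+ 2 + q%:R * s * Q.
  by field; lra.
have : (s - t) * y j0 ^+ 2 <= (s - t) * ((q%:R - 1) * Q)
  by rewrite ler_pM2l //; lra.
nra.
Qed.

(** * Slow mixing *)

Definition relabel (q m N : nat) (f : {perm 'I_q}) (sigma : config q m N) :
  config q m N := [ffun v => f (sigma v)].

Lemma relabel_inj (q m N : nat) (f : {perm 'I_q}) :
  injective (@relabel q m N f).
Proof.
move=> s u /ffunP su; apply/ffunP => v; have := su v.
by rewrite !ffunE => /perm_inj.
Qed.

Lemma gibbs_relabel (R : realType) (lambda J beta : R) (q m N : nat)
    (f : {perm 'I_q}) (sigma : config q m N) :
  gibbs lambda J beta (relabel f sigma) = gibbs lambda J beta sigma.
Proof.
congr (expR (_ * _) / _); apply: eq_bigr => v _; apply: eq_bigr => w _.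
by rewrite !ffunE (inj_eq perm_inj).
Qed.

(** [S] and its relabelled image are disjoint and have equal Gibbs mass. *)
Lemma gibbs_le_half (R : realType) (lambda J beta : R) (q m N : nat)
    (f : {perm 'I_q}) (S : {set config q m N}) : (0 < q)%N ->
  (forall sigma, sigma \in S -> relabel f sigma \notin S) ->
  \sum_(sigma in S) gibbs lambda J beta sigma <= 1 / 2.
Proof.
move=> q0 fS; pose g := @gibbs R lambda J beta q m N.
have imS : \sum_(s in S) g s = \sum_(s in [set relabel f x | x in S]) g s.
  rewrite big_imset /=; last by move=> x y _ _; exact: relabel_inj.
  by apply: eq_bigr => s _; rewrite /g gibbs_relabel.
have : \sum_(s in S) g s + \sum_(s in [set relabel f x | x in S]) g s <= 1.
  rewrite -(@sum_gibbs R lambda J beta q m N q0) [leRHS](bigID (mem S)) /=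
    lerD2l.
  rewrite [leRHS](bigID (mem [set relabel f x | x in S])) /=.
  rewrite -[leLHS]addr0 lerD //; last first.
    by apply: sumr_ge0 => s _; rewrite ltW ?gibbs_gt0.
  rewrite le_eqVlt; apply/predU1P; left; apply: eq_bigl => s.
  rewrite andb_idl // => /imsetP[x xS ->]; exact: fS.
by rewrite -imS -/g; lra.
Qed.

Lemma spin_count_relabel (q m N : nat) (f : {perm 'I_q})
    (sigma : config q m N) (k : 'I_m) (j : 'I_q) :
  spin_count (relabel f sigma) k (f j) = spin_count sigma k j.
Proof. by apply: eq_bigr => i _; rewrite ffunE (inj_eq perm_inj). Qed.

Lemma deviation_le_sqdev (R : realType) (q m N : nat) (p : 'I_q -> R)
    (sigma : config q m N) (k : 'I_m) (j : 'I_q) :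
  deviation p sigma k j ^+ 2 <= sqdev p sigma.
Proof.
rewrite /sqdev (bigD1 k) //= (bigD1 j) //= -addrA lerDl addr_ge0 //.
  by apply: sumr_ge0 => i _; exact: sqr_ge0.
by apply: sumr_ge0 => i _; apply: sumr_ge0 => i' _; exact: sqr_ge0.
Qed.

Lemma spin_count_agree_off (q m N : nat) (v : vertex m N)
    (sigma tau : config q m N) (k : 'I_m) (j : 'I_q) :
  agree_off v sigma tau -> (spin_count tau k j <= (spin_count sigma k j).+1)%N.
Proof.
move=> /forallP st; rewrite -addn1.
apply: (@leq_trans (\sum_(i < N) ((sigma (k, i) == j) + ((k, i) == v)))%N).
  apply: leq_sum => i _; have := st (k, i).
  by case: ((k, i) == v) => /= [_|/eqP ->];
    rewrite ?addn0 // addn1 (leq_trans (leq_b1 _)).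
rewrite big_split /= leq_add2l.
case: v st => k' i' _; rewrite (bigD1 i') //= big1 => [|i /negPf ii].
  by rewrite addn0 leq_b1.
by rewrite xpair_eqE ii andbF.
Qed.

(** A deviation [x] with [|x| <= 1] moves by [u] with [|u| <= 1 / N], so its square grows by at most
    [2 * |u| + u ^+ 2 <= 3 / N]. *)
Lemma sqdev_agree_off (R : realType) (q m N : nat) (p : 'I_q -> R)
    (v : vertex m N) (sigma tau : config q m N) :
  (0 < N)%N -> (forall j, 0 <= p j <= 1) -> agree_off v sigma tau ->
  sqdev p tau <= sqdev p sigma + 3 * m%:R * q%:R / N%:R.
Proof.
move=> N0 p01 st.
have NR : 0 < N%:R :> R by rewrite ltr0n.
have -> : 3 * m%:R * q%:R / N%:R = \sum_(k < m) \sum_(j < q) 3 / N%:R :> R.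
  by rewrite !sumr_const !card_ord -(mulr_natl (3 / N%:R)) -(mulr_natl (_ *
    _)); field; lra.
rewrite -big_split /=; apply: ler_sum => k _; rewrite -big_split /=.
apply: ler_sum => j _; rewrite /deviation.
have h1 := spin_count_agree_off k j st.
have h2 := spin_count_agree_off k j (etrans (agree_off_sym v tau sigma) st).
have h3 := spin_count_le sigma k j.
have h4 := p01 j.
set n := spin_count sigma k j in h1 h2 h3 *;
  set n' := spin_count tau k j in h1 h2 *.
have {}h1 : n'%:R <= n%:R + 1 :> R by rewrite natr1 ler_nat.
have {}h2 : n%:R <= n'%:R + 1 :> R by rewrite natr1 ler_nat.
have {}h3 : n%:R <= N%:R :> R by rewrite ler_nat.
have h0 : 0 <= n%:R :> R by rewrite ler0n.
have N1 : 1 <= N%:R :> R by rewrite ler1n.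
pose x : R := n%:R / N%:R - p j; pose u : R := n'%:R / N%:R - n%:R / N%:R.
have uE : N%:R * u = n'%:R - n%:R by rewrite /u; field; lra.
pose w : R := N%:R^-1.
have Nw : N%:R * w = 1 by rewrite /w divff //; lra.
have w0 : 0 < w by rewrite invr_gt0.
have nw : n%:R / N%:R <= 1 :> R by rewrite ler_pdivrMr //; lra.
have nw0 : 0 <= n%:R / N%:R :> R by rewrite divr_ge0.
have x1 : - 1 <= x by rewrite /x; lra.
have x2 : x <= 1 by rewrite /x; lra.
have u1 : u <= w by rewrite -(ler_pM2l NR) uE Nw; lra.
have u2 : - w <= u by rewrite -(ler_pM2l NR) mulrN uE Nw; lra.
have -> : n'%:R / N%:R - p j = x + u by rewrite /x /u; ring.
have w1 : w <= 1 by rewrite invf_le1.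
rewrite -/x -/w sqrrD.
have : x * u <= w by nra.
have : u ^+ 2 <= w by nra.
lra.
Qed.

(** Since [b <= 1], [expR (b * N) >= b * (N + 1)]. Raising this to the power [k + 1] leaves one
    spare factor [N + 1], which absorbs [C] for large [N]. *)
Lemma poly_le_expR (R : realType) (C a : R) (k : nat) : 0 < a ->
  exists N0 : nat, forall N : nat, (N0 <= N)%N ->
    C * N.+1%:R ^+ k <= expR (a * N%:R).
Proof.
move=> a0; pose b := Num.min 1 (a / k.+1%:R).
have b0 : 0 < b by rewrite lt_min ltr01 divr_gt0.
have b1 : b <= 1 by rewrite ge_min lexx.
have ba : b * k.+1%:R <= a by rewrite -ler_pdivlMr // ge_min lexx orbT.
have bk : 0 < b ^+ k.+1 by rewrite exprn_gt0.
exists (Num.bound (`|C| / b ^+ k.+1)) => N hN.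
have CN : C <= b ^+ k.+1 * N.+1%:R.
  apply: (le_trans (ler_norm C)); rewrite mulrC -ler_pdivrMr //.
  apply: ltW; apply: (lt_le_trans (archi_boundP _));
    first by rewrite divr_ge0 // ltW.
  by rewrite ler_nat (leq_trans hN).
apply: (@le_trans _ _ (b ^+ k.+1 * N.+1%:R * N.+1%:R ^+ k)).
  by rewrite ler_wpM2r ?exprn_ge0.
rewrite -mulrA -exprS -exprMn.
apply: (@le_trans _ _ (expR (b * N%:R) ^+ k.+1)).
  rewrite lerXn2r ?nnegrE ?expR_ge0 ?mulr_ge0 ?(ltW b0) //.
  apply: le_trans (expR_ge1Dx _).
  by rewrite -natr1 mulrDr mulr1 addrC lerD2r.
rewrite -expRM_natl ler_expR mulrA [_ * b]mulrC.
by rewrite ler_wpM2r ?ler0n.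
Qed.

Unset Implicit Arguments.

Theorem theorem2 (R : realType) (q m : nat) (lambda J beta : R)
    (hq : (3 <= q)%N) (hm : (1 <= m)%N)
    (hlambda0 : 0 < lambda) (hlambda1 : lambda < 1) (hJ : 0 < J)
    (hbeta0 : 0 < beta) (hbeta : beta_s R q / J < beta) :
  exists (c : R) (N0 : nat), 0 < c /\
    forall N : nat, (N0 <= N)%N ->
      ((expR (c * N%:R))%:E <= mixing_time lambda J beta q m N)%E.
Proof.
have q0 : (0 < q)%N by exact: ltn_trans hq.
have q1 : (1 < q)%N by exact: ltn_trans hq.
pose B := beta * J.
have B0 : 0 < B by rewrite mulr_gt0.
have hB : beta_s R q < B by rewrite -ltr_pdivrMr.
have [s [t [t0 ts st1 tE stB]]] := stable_fixpoint hq B0 hB.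
pose j0 := Ordinal q0; pose j1 := Ordinal q1.
pose p (j : 'I_q) := if j == j0 then s else t.
have qR : 3 <= q%:R :> R by rewrite ler_nat.
have p1 : \sum_j p j = 1.
  rewrite (bigD1 j0) //= /p eqxx (eq_bigr (fun=> t)) => [|j /negPf -> //].
  rewrite sumr_const (cardC1 j0) card_ord -mulr_natl -subn1 natrB //.
have tp j : t <= p j by rewrite /p; case: ifP => // _; exact: ltW.
have p01 j : 0 <= p j <= 1.
  by rewrite (le_trans (ltW t0) (tp j)) /= /p; case: ifP => _; nra.
have p0 j : 0 <= p j by case/andP: (p01 j).
(* The constant is read off at [j0]; the equation [tE] makes it the same for the other colours. *)
have pE j : p j = s * expR (- (2 * B * s)) * expR (2 * B * p j).
  rewrite -mulrA -expRD /p; case: ifP => _.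
    by rewrite addNr expR0 mulr1.
  by rewrite [LHS]tE; congr (_ * expR _); ring.
have C0 : 0 < s * expR (- (2 * B * s)) by rewrite mulr_gt0 ?expR_gt0 //; lra.
have [kappa kappa0 form] := stable_quadratic_form j0 t0 ts st1 stB.
have [d d0 shell] := @sqdev_shell R q m p t B kappa t0 tp p1 kappa0 form.
(* The second bound gives [t + delta < s - delta], so that swapping two colours moves the ball off
   itself. *)
pose delta := Num.min d ((s - t) / 3).
have delta0 : 0 < delta by rewrite lt_min d0 divr_gt0 //; lra.
have deltad : delta <= d by rewrite ge_min lexx.
have deltast : delta <= (s - t) / 3 by rewrite ge_min lexx orbT.
have [c1 c10 tail] := @sqdev_tail R q m p delta q0 hm p0 p1 delta0.
have delta20 : 0 < delta ^+ 2 by rewrite exprn_gt0.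
(* Half the decay rate of the shell; the other half absorbs [8 * N.+1 ^ (m * q)]. *)
pose c := kappa * delta ^+ 2 / 8.
have c0 : 0 < c by rewrite /c !mulr_gt0.
have [N1 hN1] := @poly_le_expR R (4 * m%:R * q%:R) c1 0 c10.
have [N2 hN2] := @poly_le_expR R 8 c (m * q) c0.
(* Beyond [N3] one update raises [sqdev] by at most [delta ^+ 2 / 2], so the chain cannot jump over
   the shell. *)
pose N3 := Num.bound (6 * m%:R * q%:R / delta ^+ 2 : R).
exists c, (maxn 1 (maxn N1 (maxn N2 N3))); split=> // N.
rewrite !geq_max => /and4P[N0 NN1 NN2 NN3].
have NR : 0 < N%:R :> R by rewrite ltr0n.
pose S : {set config q m N} := [set x | sqdev p x <= delta ^+ 2].
pose A : {set config q m N} := [set x | delta ^+ 2 / 2 <= sqdev p x <= delta ^+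
  2].
have [K K0 hK] := @gibbs_weight_product R lambda J beta _ q m N p N0 hm
  hlambda0 hlambda1 hJ hbeta0 C0 pE.
have S_half : 1 / 2 <= \sum_(x in S) iid_weight p x.
  have := @sum_iid_weight R q m N p p1; rewrite (bigID (mem S)) /=.
  have := tail N N0; rewrite (eq_bigl (fun x => x \notin S)); last first.
    by move=> x; rewrite inE ltNge.
  have := hN1 N NN1; rewrite expr0 mulr1 => h.
  suff : 2 * m%:R * q%:R * expR (- (c1 * N%:R)) <= 1 / 2 by lra.
  by rewrite expRN ler_pdivrMr ?expR_gt0 //; lra.
pose Z := partition_function lambda J beta q m N.
have Z0 : 0 < Z by exact: partition_function_gt0.
have gS : K / 2 / Z <= \sum_(x in S) gibbs lambda J beta x.
  rewrite /gibbs -mulr_suml ler_pM2r ?invr_gt0 //.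
  apply: (@le_trans _ _ (\sum_(x in S) K * iid_weight p x)).
    by rewrite -mulr_sumr ler_pM2l //; lra.
  by apply: ler_sum => x _; case: (hK x).
(* The factor 2 comes from the ball having product mass at least 1/2. *)
pose e := 2 * N.+1%:R ^+ (m * q) * expR (- (kappa * delta ^+ 2 / 4 * N%:R)).
have e0 : 0 < e by rewrite /e !mulr_gt0 ?expR_gt0 ?exprn_gt0.
have gA : \sum_(x in A) gibbs lambda J beta x <= e * (K / 2 / Z).
  rewrite /gibbs -mulr_suml !mulrA ler_pM2r ?invr_gt0 //.
  apply: (@le_trans _ _ (\sum_(x in A) K * (iid_weight p x * expR (N%:R * B *
    sqdev p x)))).
    by apply: ler_sum => x _; case: (hK x).
  rewrite -mulr_sumr.
  have -> : e * K / 2 = K * (N.+1%:R ^+ (m * q) * expR (- (kappa * delta ^+ 2 /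
    4 * N%:R))).
    by rewrite /e; field.
  rewrite ler_pM2l //; apply: le_trans (shell delta N delta0 deltad N0).
  by rewrite le_eqVlt; apply/predU1P; left; apply: eq_bigl => x; rewrite inE.
have exitA v x y : agree_off v x y -> x \in S -> y \notin S -> x \in A.
  rewrite !inE -ltNge => xy xS yS; rewrite xS andbT.
  have := sqdev_agree_off N0 p01 xy.
  suff : 3 * m%:R * q%:R / N%:R <= delta ^+ 2 / 2 by lra.
  have : 6 * m%:R * q%:R / delta ^+ 2 <= N%:R.
    apply: ltW; apply: (lt_le_trans (archi_boundP _)); last by rewrite ler_nat.
    by rewrite divr_ge0 ?mulr_ge0 ?ler0n // ltW.
  by rewrite !ler_pdivrMr //; lra.
(* The proportion [z] of colour [j1] in [x] is that of [j0] after the swap; it would be both at most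
   [t + delta] and at least [s - delta]. *)
have swapS x : x \in S -> relabel (tperm j1 j0) x \notin S.
  rewrite !inE => xS; apply/negP => xS'.
  pose k : 'I_m := Ordinal hm.
  have := le_trans (deviation_le_sqdev p x k j1) xS.
  have := le_trans (deviation_le_sqdev p (relabel (tperm j1 j0) x) k j0) xS'.
  have := spin_count_relabel (tperm j1 j0) x k j1; rewrite tpermL => cE.
  rewrite /deviation cE /p eqxx /=.
  set z := _ / _ => h1 h2.
  have : s - delta <= z by nra.
  have : z <= t + delta by nra.
  lra.
have Kp : 0 < K / 2 / Z by rewrite !divr_gt0.
apply: le_trans (@mixing_time_ge R lambda J beta e q m N S A q0 hm N0 exitA _ _
  e0).
- rewrite lee_fin ler_pdivlMr; last by rewrite mulr_gt0.
  rewrite /e expRN.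
  have h := hN2 N NN2.
  have -> : kappa * delta ^+ 2 / 4 * N%:R = c * N%:R + c * N%:R by rewrite /c;
    field.
  rewrite expRD; set E := expR (c * N%:R) in h *.
  have E0 : 0 < E by exact: expR_gt0.
  have -> : E * (4 * (2 * N.+1%:R ^+ (m * q) / (E * E))) = 8 * N.+1%:R ^+ (m *
    q) / E.
    by field; lra.
  by rewrite ler_pdivrMr ?mul1r.
- apply/andP; split; first exact: lt_le_trans Kp gS.
  exact: gibbs_le_half swapS.
- by apply: (le_trans gA); rewrite ler_pM2l.
Qed.
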